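(* For every totally bounded metric space $(X,d)$ and every continuous (not necessarily uniformly continuous) self-map $f:X\to X$, $$h_F(f)=h_{BD}(f,X,d)\ \geq\ h_{Bc}(f,X,d),$$ where $h_F$, $h_{BD}$ and $h_{Bc}$ denote the Friedland entropy, the Bowen-Dinaburg entropy and the Bowen compacta entropy, respectively.
   Context: Let $(X,d)$ be a totally bounded metric space and $f:X\to X$ continuous. For $n\ge 1$ the Bowen-Dinaburg metric is $d^f_n(x,x')=\max_{0\le i<n} d(f^i(x),f^i(x'))$; it is again a totally bounded metric on $X$. For a totally bounded metric $\delta$ on $X$, $\varepsilon>0$ and $K\subset X$: a set $S$ is $\varepsilon$-separated with respect to $\delta$ if $\delta(s,s')\ge\varepsilon$ for all distinct $s,s'\in S$; a set $S\subset X$ $\varepsilon$-spans $K$ if for every $x\in K$ there is $s\in S$ with $\delta(x,s)<\varepsilon$. Put $\operatorname{maxsep}[K,\delta,\varepsilon]=\max\{\operatorname{card} S: S\subset K \text{ is } \varepsilon\text{-separated w.r.t. }\delta\}$ and $\operatorname{minspan}[K,\delta,\varepsilon]=\min\{\operatorname{card} S: S\subset X\ \varepsilon\text{-spans } K \text{ w.r.t. }\delta\}$ (both finite by total boundedness). For a sequence of positive reals, $GR\{c_n\}=\limsup_{n\to\infty}\frac1n\log c_n$. The Bowen-Dinaburg entropy of $f$ on a subset $K\subset X$ (not assumed $f$-invariant) is $$h_{BD}(f,K,d)=\lim_{\varepsilon\to0}GR\{\operatorname{maxsep}[K,d^f_n,\varepsilon]\}=\lim_{\varepsilon\to0}GR\{\operatorname{minspan}[K,d^f_n,\varepsilon]\}$$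 (the two limits agree). The Bowen compacta entropy is $h_{Bc}(f,X,d)=\sup\{h_{BD}(f,K,d): K\subset X \text{ compact}\}$. Friedland entropy: let $\hat X$ be the completion of $(X,d)$, which is compact, and let $\hat X^{\mathbb N}$ be the space of sequences $\mathbf x=x_0x_1x_2\dots$ in $\hat X$ with the product topology (compact metrizable), with shift map $\sigma(\mathbf x)_i=x_{i+1}$, $i=0,1,\dots$. Let $X^f=\{\mathbf x\in X^{\mathbb N}: x_{i+1}=f(x_i)\text{ for } i=0,1,\dots\}\subset \hat X^{\mathbb N}$. Its closure $\operatorname{clos}X^f$ in $\hat X^{\mathbb N}$ is compact and $\sigma$-invariant, and $h_F(f)$ is defined as the (usual) topological entropy of $\sigma$ restricted to $\operatorname{clos}X^f$. *)

(* Defs.v *)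
From HB Require Import structures.
From mathcomp Require Import all_boot all_order all_algebra.
From mathcomp Require Import all_classical all_reals all_analysis.

Set Implicit Arguments.
Unset Strict Implicit.
Unset Printing Implicit Defensive.

Import Order.TTheory GRing.Theory Num.Theory.
Import numFieldTopology.Exports numFieldNormedType.Exports.

Local Open Scope classical_set_scope.
Local Open Scope ring_scope.
Local Open Scope ereal_scope.

(* Cardinalities are taken in [\bar R] ([counting] is the number of elements of
   a finite set and [+oo] for an infinite one) and [lne 0 = -oo], so every
   quantity below is meaningful for all inputs; on the empty space all the
   entropies are [-oo]. *)
Definition growth_rate (R : realType) (c : (\bar R)^nat) : \bar R :=
  limn_esup (fun n => (n%:R^-1)%:E * lne (c n)).

Section BowenDinaburg.
Variables (R : realType) (X : choiceType).
Implicit Types (d : X -> X -> R) (f : X -> X) (K S : set X).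

(* The seed 0 of the maximum is harmless for n >= 1 because distances are
   nonnegative; the value at n = 0 does not affect growth rates. *)
Definition bowen_dist d f (n : nat) : X -> X -> R :=
  fun x x' => (\big[Num.max/0]_(i < n) d (iter i f x) (iter i f x'))%R.

Definition separated d (e : R) S :=
  forall s s', S s -> S s' -> s <> s' -> (e <= d s s')%R.

Definition spans d (e : R) K S :=
  forall x, K x -> exists2 s, S s & (d x s < e)%R.

Definition totally_bounded d :=
  forall e : R, (0 < e)%R ->
    exists2 S : set X, finite_set S & spans d e [set: X] S.

Definition maxsep K d (e : R) : \bar R :=
  ereal_sup [set counting S | S in [set S | S `<=` K /\ separated d e S]].

(* The limit exists because [maxsep] is nonincreasing in e. *)
Definition bd_entropy f K d : \bar R :=
  lim (growth_rate (fun n => maxsep K (bowen_dist d f n) e) @[e --> 0^'+]).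

End BowenDinaburg.

Definition bowen_compacta_entropy (R : realType) (X : metricType R)
    (f : X -> X) : \bar R :=
  ereal_sup [set bd_entropy f K (@mdist R X) | K in [set K : set X | compact K]].

(* Topological entropy of a self-map of a (compact) topological space, defined
   by open covers (Adler, Konheim and McAndrew). The limsup in [growth_rate] is
   a limit here, because n |-> ln N(U v ... v g^-(n-1) U) is subadditive. *)
Section TopologicalEntropy.
Variable T : topologicalType.
Implicit Types (g : T -> T) (U V : set (set T)).

Definition covers U := \bigcup_(A in U) A = [set: T].

Definition open_cover U := (forall A, U A -> open A) /\ covers U.

(* The join of U, g^-1 U, ..., g^-(n-1) U. *)
Definition iterated_join g U (n : nat) : set (set T) :=
  [set \bigcap_(i in `I_n) (iter i g @^-1` A i) | A in
    [set A : nat -> set T | forall i, (i < n)%N -> U (A i)]].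

Definition min_subcover (R : realType) U : \bar R :=
  ereal_inf [set counting V | V in [set V | V `<=` U /\ covers V]].

Definition topological_entropy (R : realType) g : \bar R :=
  ereal_sup [set growth_rate (fun n => min_subcover R (iterated_join g U n)) |
    U in [set U | open_cover U]].

End TopologicalEntropy.

(* [Xh] with [iota] is a completion of [X]. The library's [completeType] is not
   used because it only covers nonempty (pointed) spaces. *)
Definition is_completion (R : realType) (X Xh : metricType R)
    (iota : X -> Xh) :=
  [/\ forall x y, mdist (iota x) (iota y) = mdist x y,
      dense (range iota) &
      forall F : set_system Xh, ProperFilter F -> cauchy F ->
        exists l : Xh, F --> l].

Section Friedland.
Variables (X : Type) (T : topologicalType) (iota : X -> T) (f : X -> X).

Definition shift (s : {ptws nat -> T}) : {ptws nat -> T} := fun i => s i.+1.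

(* Orbits of f in X, seen in T^N through the embedding [iota]. *)
Definition orbit_space : set {ptws nat -> T} :=
  [set s | exists2 x : nat -> X, forall i, x i.+1 = f (x i) & s = iota \o x].

Lemma shift_continuous : continuous shift.
Proof.
move=> s; apply/cvg_sup; first exact/fmap_filter/(nbhs_filter s).
move=> i U; rewrite /nbhs/= => -[_ [[W oW <-] /= Ws WU]].
have sW : nbhs s (proj i.+1 @^-1` W).
  by apply: (@proj_continuous nat (fun=> T) i.+1 s); exact: open_nbhs_nbhs.
by apply: (@filterS _ _ (nbhs_filter s) _ _ _ sW) => u; exact: (WU (shift u)).
Qed.

Lemma shift_closure_orbit_space s :
  s \in closure orbit_space -> shift s \in closure orbit_space.
Proof.
move=> /set_mem clAs; apply/mem_set => B /shift_continuous /clAs.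
move=> [_ [[x xf ->] Bx]]; exists (shift (iota \o x)); split=> //.
by exists (fun i => x i.+1).
Qed.

Definition shift_orbit_closure (s : closure orbit_space) :
    closure orbit_space :=
  SigSub (shift_closure_orbit_space (valP s)).

Definition friedland_entropy (R : realType) : \bar R :=
  topological_entropy R shift_orbit_closure.

End Friedland.

(* Main.v *)
Require Import Defs.
From HB Require Import structures.
From mathcomp Require Import all_boot all_order all_algebra finmap.
From mathcomp Require Import all_classical all_reals all_analysis.

Set Implicit Arguments.
Unset Strict Implicit.
Unset Printing Implicit Defensive.

Import Order.TTheory GRing.Theory Num.Theory.
Import numFieldTopology.Exports numFieldNormedType.Exports.

Local Open Scope classical_set_scope.
Local Open Scope ring_scope.
Local Open Scope ereal_scope.

(** The argument is the classical comparison of two ways of counting orbits of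
length n at a fixed scale, carried out between X and the closure Y of the orbit
space in the sequences of points of the completion.

The point x of X is represented in Y by its orbit. Since the completion map is
isometric, two orbits are Bowen-close at scale e and length n exactly when their
first n coordinates are close at scale e, that is, when the 0-th coordinates of
their first n shifts are.

- Separated sets inject into subcovers ([maxsep_le_min_subcover]). Take the cover
  of Y by the open sets on which the 0-th coordinate has oscillation less than
  e. An element of its n-th iterated join contains at most one point of an
  e-separated set, so each subcover of the join has at least as many elements
  as the separated set has points.

- Spanning sets produce subcovers ([min_subcover_le_maxsep]). The space Y is
  compact, being closed in a power of the compact completion, so an open cover
  U of Y has a Lebesgue number: a scale e and a number m of coordinates such
  that agreement up to e on m coordinates forces membership in a common element
  of U ([lebesgue_number]). A maximal e/2-separated set for the Bowen distance
  of length n + m spans X; orbits are dense in Y, so the cylinders of size e and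
  length n + m around the orbits of its points cover Y, and each of them lies in
  an element of the n-th iterated join of U.

The first point gives one inequality at once. For the second one the excess
length m has to be absorbed, which is harmless because growth rates ignore a
shift of the index ([growth_rate_shift]).

Finally, a separated subset of a compact set is a separated subset of X, so the
entropy on every compact set is at most that on X ([sub_bd_entropy]). *)

(** * Cardinalities and growth rates *)

Lemma le_counting (R : realType) (T U : choiceType) (A : set T) (B : set U) :
  (A #<= B)%card -> counting A <= counting B :> \bar R.
Proof.
move=> AB; rewrite {2}/counting; case: ifPn => [/asboolP finB|_]; last exact: leey.
have finA := card_le_finite AB finB.
rewrite /counting asboolT// lee_fin ler_nat; apply: geq_card_fset_set.
have /finite_setP[n Bn] := finB.
by rewrite (card_fset_set Bn) (card_le_trans AB)// (card_le_eql Bn) card_lexx.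
Qed.

Lemma le_lne (R : realType) : {homo @lne R : x y / x <= y}.
Proof.
move=> x y xy; have [x0|x0] := leP x 0; first by rewrite le0_lneNy// leNye.
by rewrite lee_lne// in_itv/= leey andbT ?(le_trans _ xy)// ltW.
Qed.

(** Reduces inequalities between limsups to eventual real bounds, with no case
analysis on infinite values. *)
Lemma lee_ub_fin (R : realType) (x y : \bar R) :
  (forall r : R, y < r%:E -> x <= r%:E) -> x <= y.
Proof.
case: y => [y| |] xy; [|exact: leey|].
- by apply/lee_addgt0Pr => e e0; apply: xy; rewrite lte_fin ltrDl.
- have {}xy r : x <= r%:E by apply: xy; exact: ltNyr.
  by case: x xy => [x|/(_ 0%R)|]// /(_ (x - 1)%R); rewrite lee_fin lerBrDr gerDl ler10.
Qed.

Lemma lt_limn_esup_near (R : realType) (u : (\bar R)^nat) (l : \bar R) :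
  limn_esup u < l -> \forall n \near \oo, u n < l.
Proof.
move=> /ereal_inf_lt[_ [V Voo <-] Vl]; apply: filterS Voo => n Vn.
by apply: le_lt_trans Vl; apply: ereal_sup_ubound; exists n.
Qed.

Lemma limn_esup_le_near (R : realType) (u : (\bar R)^nat) (l : \bar R) :
  (\forall n \near \oo, u n <= l) -> limn_esup u <= l.
Proof.
move=> ul; apply: (@le_trans _ _ (ereal_sup (u @` [set n | u n <= l]))).
  by apply: ereal_inf_lbound; exists [set n | u n <= l].
by apply: ge_ereal_sup => _ [n + <-].
Qed.

Lemma le_growth_rate (R : realType) (a b : (\bar R)^nat) :
  (forall n, a n <= b n) -> growth_rate a <= growth_rate b.
Proof.
move=> ab; apply: lee_ub_fin => r /lt_limn_esup_near br.
apply: limn_esup_le_near; apply: filterS br => n /ltW; apply: le_trans.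
by rewrite lee_wpmul2l ?lee_fin// le_lne.
Qed.

(** If ln c(n) <= r n eventually, then ln c(n + m) / n <= r + m r / n, and the
last term vanishes. Only the upper bound r is manipulated, so the values of c may
be zero or infinite. *)
Lemma growth_rate_shift (R : realType) (c : (\bar R)^nat) (m : nat) :
  growth_rate (fun n => c (n + m)%N) <= growth_rate c.
Proof.
apply: lee_ub_fin => r /lt_limn_esup_near -[N _ cr].
apply/lee_addgt0Pr => e e0; apply: limn_esup_le_near; near=> n.
have n0 : (0 < n)%N by near: n; exact: nbhs_infty_gt.
have nr0 : (0 < n%:R :> R)%R by rewrite ltr0n.
have nN : (N <= n + m)%N.
  by apply: leq_trans (leq_addr _ _); near: n; exact: nbhs_infty_ge.
have := cr _ nN; rewrite /= => /ltW.
rewrite !lee_pdivrMl// ?ltr0n ?addn_gt0 ?n0// => /le_trans; apply.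
rewrite -EFinD -!EFinM lee_fin natrD mulrDl mulrDr lerD2l -ler_pdivrMr//.
by near: n; exact: nbhs_infty_ger.
Unshelve. all: by end_near. Qed.

(** * Bowen-Dinaburg entropy *)

Lemma sub_maxsep (R : realType) (X : choiceType) (d : X -> X -> R) (e : R) :
  {homo (fun K => maxsep K d e) : K L / K `<=` L >-> K <= L}.
Proof.
move=> K L KL; apply: ereal_sup_le => _ [S [SK sepS] <-].
by exists S => //; split=> //; exact: subset_trans KL.
Qed.

Lemma maxsep_nonincreasing (R : realType) (X : choiceType) (K : set X)
    (d : X -> X -> R) :
  {homo maxsep K d : e e' / (e <= e')%R >-> e' <= e}.
Proof.
move=> e e' ee'; apply: ereal_sup_le => _ [S [SK sepS] <-].
exists S => //; split=> // s s' Ss Ss' ss'.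
exact: le_trans ee' (sepS _ _ Ss Ss' ss').
Qed.

(** The limit as e decreases to 0 is that of a function nonincreasing in e, hence
a supremum; in this form it can be compared scale by scale. *)
Lemma bd_entropyE (R : realType) (X : choiceType) (f : X -> X) (K : set X)
    (d : X -> X -> R) :
  bd_entropy f K d = ereal_sup
    [set growth_rate (fun n => maxsep K (bowen_dist d f n) e) |
      e in [set e | (0 < e)%R]].
Proof.
apply/cvg_lim => //.
have /= := @nonincreasing_at_right_cvge R
  (fun e => growth_rate (fun n => maxsep K (bowen_dist d f n) e)) 0%R +oo%O isT.
rewrite set_itvE; apply => e e' _ _ ee'.
by apply: le_growth_rate => n; exact: maxsep_nonincreasing.
Qed.

Lemma sub_bd_entropy (R : realType) (X : choiceType) (f : X -> X)
    (d : X -> X -> R) :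
  {homo (fun K => bd_entropy f K d) : K L / K `<=` L >-> K <= L}.
Proof.
move=> K L KL; rewrite !bd_entropyE; apply: ge_ereal_sup => _ [e e0 <-].
apply: le_trans (ereal_sup_ubound _); last by exists e.
by apply: le_growth_rate => n; exact: sub_maxsep.
Qed.

(** Positivity of e accounts for the seed 0 of the maximum; in particular all
points are within e of each other when n = 0. *)
Lemma bowen_distP (R : realType) (X : choiceType) (d : X -> X -> R)
    (f : X -> X) (n : nat) (e : R) (x y : X) : (0 < e)%R ->
  (bowen_dist d f n x y < e)%R <->
  forall i, (i < n)%N -> (d (iter i f x) (iter i f y) < e)%R.
Proof.
move=> e0; split=> [/bigmax_ltP[_ xy] i ni|xy].
  exact: (xy (Ordinal ni)).
by apply/bigmax_ltP; split=> // i _; exact: xy.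
Qed.

(** * Compactness of the completion *)

Lemma dense_mdist (R : realType) (T : metricType R) (A : set T) (y : T)
    (e : R) : dense A -> (0 < e)%R -> exists2 a, A a & (mdist y a < e)%R.
Proof.
move=> dA e0; have yb : nbhs y (ball y e) by exact: nbhsx_ballx.
have [|a [/interior_subset]] := dA (ball y e)° _ (@open_interior _ _).
  by exists y; exact: nbhs_singleton (nbhs_interior yb).
by rewrite ballEmdist /= => ya Aa; exists a.
Qed.

Lemma completion_totally_bounded (R : realType) (X Xh : metricType R)
    (iota : X -> Xh) : is_completion iota ->
  totally_bounded (@mdist R X) -> totally_bounded (@mdist R Xh).
Proof.
move=> [iso dns _] tbX e e0; have e20 : (0 < e / 2)%R by rewrite divr_gt0.
have [S finS spanS] := tbX _ e20.
exists (iota @` S); first exact: finite_image.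
move=> y _; have [_ [x _ <-] yx] := dense_mdist y dns e20.
have [s Ss xs] := spanS x I; exists (iota s); first by exists s.
by rewrite (le_lt_trans (metric_triangle y (iota x) _))// iso (splitr e) ltrD.
Qed.

(** An ultrafilter contains one of the finitely many e-balls that cover the
space, for every e; hence it is Cauchy, and completeness makes it converge. *)
Lemma complete_totally_bounded_compact (R : realType) (T : metricType R) :
  totally_bounded (@mdist R T) ->
  (forall F : set_system T, ProperFilter F -> cauchy F -> exists l : T, F --> l) ->
  compact [set: T].
Proof.
move=> tbT cplT; rewrite compact_ultra => F FU _.
suff /cplT[l Fl] : cauchy F by exists l.
apply: cauchy_exP => e e0; have [S finS spanS] := tbT _ e0.
apply: contrapT => /forallNP nF.
have : F (\bigcap_(s in [set` fset_set S]) ~` ball s e).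
  apply: filter_bigI => s _.
  by have [/nF|] := in_ultra_setVsetC (ball s e) FU.
move=> /filter_ex[y yN]; have [s Ss ys] := spanS y I.
apply: (yN s); first by rewrite /= in_fset_set// inE.
by rewrite ballEmdist /= metric_sym.
Qed.

Lemma completion_compact (R : realType) (X Xh : metricType R)
    (iota : X -> Xh) : totally_bounded (@mdist R X) -> is_completion iota ->
  compact [set: Xh].
Proof.
move=> tbX cplXh; have [_ _ cpl] := cplXh.
apply: (complete_totally_bounded_compact _ cpl).
exact: completion_totally_bounded cplXh tbX.
Qed.

Lemma compact_ptws (T : topologicalType) :
  compact [set: T] -> compact [set: {ptws nat -> T}].
Proof.
move=> cT; have := @tychonoff nat (fun=> T) (fun=> setT) (fun=> cT).
by congr compact; apply/seteqP; split.
Qed.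

(** * Cylinders in a sequence space *)

Section Cylinders.
Variables (R : realType) (T : metricType R).
Implicit Types (y z : {ptws nat -> T}) (e : R) (m : nat).

Definition cylinder y m e : set {ptws nat -> T} :=
  [set z | forall i, (i < m)%N -> (mdist (y i) (z i) < e)%R].

Lemma nbhs_cylinder y m e : (0 < e)%R -> nbhs y (cylinder y m e).
Proof.
move=> e0; elim: m => [|m IHm]; first by apply: filterS filterT => z _ [].
have ym : nbhs y (proj m @^-1` (ball (y m) e)).
  by apply: (@proj_continuous nat (fun=> T) m y); exact: nbhsx_ballx.
apply: filterS2 IHm ym => z yz; rewrite /= /proj ballEmdist /= => ymz i.
by rewrite ltnS leq_eqVlt => /predU1P[->//|]; exact: yz.
Qed.

(** The cylinders around y generate a filter which converges to y in each
coordinate, hence in the product topology. *)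
Lemma nbhs_ptwsP y (W : set {ptws nat -> T}) : nbhs y W ->
  exists2 p : nat * R, (0 < p.2)%R & cylinder y p.1 p.2 `<=` W.
Proof.
pose F := filter_from [set p : nat * R | (0 < p.2)%R]
  (fun p => cylinder y p.1 p.2).
have FF : Filter F.
  apply: filter_from_filter; first by exists (0%N, 1%R) => /=.
  move=> [m e] [m' e'] /= e0 e'0; exists (maxn m m', Num.min e e') => /=.
    by rewrite lt_min e0.
  move=> z yz; split=> i im; have := yz i.
    by rewrite lt_min leq_max im => /(_ isT)/andP[].
  by rewrite lt_min leq_max im orbT => /(_ isT)/andP[].
suff Fy : F --> y by move=> /Fy[p p0 pW]; exists p.
apply/cvg_sup => i U; rewrite /nbhs /= => -[_ [[W' oW' <-] /= W'y W'U]].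
have := open_nbhs_nbhs (conj oW' W'y); rewrite -nbhs_ballE => -[e /= e0 eW'].
exists (i.+1, e) => //= z yz; apply: W'U; apply: eW'.
by rewrite ballEmdist /=; exact: yz.
Qed.

(** The property that a cylinder of length k and size 1/(k+1) is contained in an
element of U holds, near each point of K, for all large k; compactness in its
near-covering form makes this k uniform. *)
Lemma lebesgue_number (K : set {ptws nat -> T}) (U : set (set K)) :
  compact K -> open_cover U ->
  exists m, exists2 e, (0 < e)%R & forall y : K,
    exists2 A, U A & forall z : K, cylinder (val y) m e (val z) -> A z.
Proof.
move=> /compact_near_coveringP cK [oU cU].
pose P (k : nat) y := exists2 A, U A &
  forall z : K, cylinder y k k.+1%:R^-1 (val z) -> A z.
have [x Kx|N _ NP] := cK nat \oo P _.
  have [A UA Ax] : (\bigcup_(A in U) A) (SigSub (mem_set Kx)) by rewrite cU.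
  have [W oW WA] := oU _ UA.
  have [|[m e] /= e0 mW] := @nbhs_ptwsP x W.
    by apply: open_nbhs_nbhs; split=> //; move: Ax; rewrite -WA.
  have e20 : (0 < e / 2)%R by rewrite divr_gt0.
  near=> y k => /=; exists A => // z yz; rewrite -WA; apply: mW => i im.
  rewrite (le_lt_trans (metric_triangle _ (y i) _))// (splitr e) ltrD//.
    by move: i im; near: y; exact: nbhs_cylinder.
  have ik : (i < k)%N.
    by apply: leq_trans im _; near: k; exact: nbhs_infty_ge.
  apply: (lt_trans (yz i ik)); near: k; exact: (near_infty_natSinv_lt (PosNum e20)).
exists N, (N.+1%:R^-1)%R => // y.
exact: NP (leqnn N) _ (set_mem (valP y)).
Unshelve. all: by end_near. Qed.

End Cylinders.

(** * Separated sets *)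

(** Sending each point of A to an element of V which contains its image is
injective when no element of V contains the images of two points. *)
Lemma card_le_separated_cover (T U : Type) (A : set T) (V : set (set U))
    (g : T -> U) : (forall a, A a -> exists2 B, V B & B (g a)) ->
  (forall B a a', V B -> A a -> A a' -> B (g a) -> B (g a') -> a = a') ->
  (A #<= V)%card.
Proof.
move=> cov sep; have /choice[h hP] a : exists B, A a -> V B /\ B (g a).
  have [/cov[B VB Ba]|nAa] := pselect (A a); first by exists B.
  by exists set0.
have hinj : {in A &, injective h}.
  move=> a a' /set_mem/[dup] Aa /hP[Va ga] /set_mem/[dup] Aa' /hP[_ ga'] haa'.
  by apply: sep Va Aa Aa' ga _; rewrite haa'.
rewrite -(card_le_eql (inj_card_eq hinj)); apply: subset_card_le.
by move=> _ [a /hP[Va _] <-].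
Qed.

(** A point that is not within e of a maximal separated set could be added to
it. Maximality is for inclusion and comes from Zorn's lemma, whether or not
separated sets are finite. *)
Lemma maximal_separated (R : realType) (X : choiceType) (d : X -> X -> R)
    (e : R) : (forall x y, d x y = d y x) -> (forall x, (d x x < e)%R) ->
  exists2 S, Defs.separated d e S & spans d e [set: X] S.
Proof.
move=> dC dxx; have [|S [sepS maxS]] := @Zorn_bigcup X (Defs.separated d e).
  move=> F sepF totF s s' [A FA As] [B FB Bs'].
  by have [AB|BA] := totF _ _ FA FB;
    [apply: sepF FB _ _ _ Bs'; exact: AB|apply: sepF FA _ _ As _; exact: BA].
exists S => // x _; apply: contrapT => /forall2NP nx.
have far s : S s -> (e <= d x s)%R.
  by move=> Ss; rewrite leNgt; apply/negP; have [] := nx s.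
apply: (maxS (x |` S)).
  split; first exact: subsetUr.
  by move=> /(_ x (or_introl erefl))/far; rewrite leNgt dxx.
move=> s s' [->|Ss] [->|Ss'] //; [by move=> _; exact: far| |exact: sepS].
by rewrite dC => _; exact: far.
Qed.

(** * Shift on the closure of the orbit space *)

Section FriedlandBowenDinaburg.
Variables (R : realType) (X Xh : metricType R) (iota : X -> Xh) (f : X -> X).
Local Notation Y := (closure (orbit_space iota f)).
Local Notation sigma := (@shift_orbit_closure X Xh iota f).
Local Notation dist n := (bowen_dist (@mdist R X) f n).

Lemma bowen_dist_sym n x y : dist n x y = dist n y x.
Proof. by apply: eq_bigr => i _; rewrite metric_sym. Qed.

Lemma bowen_distxx n (e : R) x : (0 < e)%R -> (dist n x x < e)%R.
Proof. by move=> e0; apply/bowen_distP => // i _; rewrite mdistxx. Qed.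

Lemma orbit_in_closure (x : X) :
  ((fun i => iota (iter i f x)) : {ptws nat -> Xh}) \in Y.
Proof.
by apply/mem_set/subset_closure; exists (fun i => iter i f x).
Qed.

Definition orbit (x : X) : Y := SigSub (orbit_in_closure x).

Lemma val_iter_sigma i (y : Y) j : val (iter i sigma y) j = val y (i + j)%N.
Proof. by elim: i j => [//|i IHi] j; rewrite addSnnS -IHi. Qed.

Lemma open_cover_small_fst (e : R) : (0 < e)%R ->
  open_cover [set A : set Y | open A /\
    forall y z, A y -> A z -> (mdist (val y 0%N) (val z 0%N) < e)%R].
Proof.
move=> e0; split=> [A []//|]; apply/seteqP; split=> // y _.
have e20 : (0 < e / 2)%R by rewrite divr_gt0.
pose B := (ball (val y 0%N) (e / 2))°.
exists (val @^-1` (proj 0%N @^-1` B)); last first.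
  exact: nbhs_singleton (nbhs_interior (nbhsx_ballx _ _ e20)).
split=> [|z z' /interior_subset + /interior_subset].
  exists (proj 0%N @^-1` B) => //; apply: open_comp; last exact: open_interior.
  by move=> ? _; exact: (@proj_continuous nat (fun=> Xh) 0%N).
rewrite ballEmdist /= => yz yz'.
rewrite (le_lt_trans (metric_triangle _ (val y 0%N) _))// (splitr e) ltrD//.
by rewrite metric_sym.
Qed.

Hypothesis iso : forall x y, mdist (iota x) (iota y) = mdist x y.

(** The cover of [open_cover_small_fst] works: if the orbits of s and s' lie in a
common element of its n-th iterated join, then the first n iterates of s and s'
are pairwise closer than e. *)
Lemma maxsep_le_min_subcover (e : R) : (0 < e)%R ->
  exists2 U : set (set Y), open_cover U & forall n,
    maxsep [set: X] (dist n) e <= min_subcover R (iterated_join sigma U n).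
Proof.
move=> e0; eexists; first exact: open_cover_small_fst e0.
move=> n; apply: ge_ereal_sup => _ [S [_ sepS] <-].
apply: le_ereal_inf_tmp => _ [V [VU cV] <-]; apply: le_counting.
apply: (@card_le_separated_cover _ _ _ _ orbit) => [x _|B s s' VB Ss Ss'].
  by have : (\bigcup_(B in V) B) (orbit x) by rewrite cV.
have [A AU <-] := VU _ VB => As As'.
apply: contrapT => /(sepS _ _ Ss Ss'); apply/negP; rewrite -ltNge.
apply/bowen_distP => // i ni; have [_] := AU _ ni.
move=> /(_ _ _ (As i ni) (As' i ni)).
by rewrite !val_iter_sigma addn0 /= iso.
Qed.

(** Let (m, e) be a Lebesgue number of U. Each x in X determines an element of the
n-th iterated join: intersect, for i < n, the preimages under the i-th shift of
an element of U that contains the cylinder around the shifted orbit of x. Taken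
over a set that e/2-spans X for the Bowen distance of length n + m, these
elements cover Y: coordinate j < m of the i-th shift is coordinate i + j < n + m,
which is under control. *)
Lemma min_subcover_le_maxsep (U : set (set Y)) : compact Y -> open_cover U ->
  exists m, exists2 e : R, (0 < e)%R & forall n,
    min_subcover R (iterated_join sigma U n) <=
    maxsep [set: X] (dist (n + m)) e.
Proof.
move=> cY oU; have [m [e e0 leb]] := lebesgue_number cY oU.
have e20 : (0 < e / 2)%R by rewrite divr_gt0.
exists m, (e / 2)%R => // n.
have /choice[a aP] (y : Y) : exists A, U A /\
    forall z : Y, cylinder (val y) m e (val z) -> A z.
  by have [A UA yA] := leb y; exists A.
have [S sepS spanS] := maximal_separated (bowen_dist_sym (n + m))
  (fun x => bowen_distxx (n + m) x e20).
pose B x := \bigcap_(i in `I_n) (iter i sigma @^-1` a (iter i sigma (orbit x))).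
apply: (@le_trans _ _ (counting (B @` S))); last first.
  apply: le_trans (ereal_sup_ubound _); last by exists S.
  exact/le_counting/card_image_le.
apply: ereal_inf_lbound; exists (B @` S) => //; split.
  move=> _ [x _ <-]; exists (fun i => a (iter i sigma (orbit x))) => //.
  by move=> i _; exact: (aP _).1.
apply/seteqP; split=> // y _.
(* An orbit that agrees with y up to e/2 on the first n + m coordinates. *)
have /(_ _ (nbhs_cylinder _ (n + m) e20))[_ [[x xf ->] yx]] := set_mem (valP y).
have {xf} xE i : x i = iter i f (x 0%N) by elim: i => // i IHi; rewrite xf IHi.
have [s Ss xs] := spanS (x 0%N) I.
exists (B s); first by exists s.
move=> i /= ni; apply: (aP _).2 => j jm; rewrite !val_iter_sigma /=.
have ij : (i + j < n + m)%N by rewrite -addSn leq_add// ltnW.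
rewrite metric_sym (le_lt_trans (metric_triangle _ (iota (x (i + j)%N)) _))//.
rewrite (splitr e) ltrD//; first exact: yx.
by rewrite iso xE; move/bowen_distP: xs; exact.
Qed.

Lemma friedland_entropyE : compact Y ->
  friedland_entropy iota f R = bd_entropy f [set: X] (@mdist R X).
Proof.
move=> cY; rewrite bd_entropyE; apply/eqP; rewrite eq_le; apply/andP; split.
  apply: ge_ereal_sup => _ [U oU <-].
  have [m [e e0 Ue]] := min_subcover_le_maxsep cY oU.
  apply: le_trans (ereal_sup_ubound _); last by exists e.
  exact: le_trans (le_growth_rate Ue) (growth_rate_shift _ m).
apply: ge_ereal_sup => _ [e e0 <-].
have [U oU eU] := maxsep_le_min_subcover e0.
apply: le_trans (le_growth_rate eU) (ereal_sup_ubound _).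
by exists U.
Qed.

End FriedlandBowenDinaburg.

Theorem theorem6 (R : realType) (X Xh : metricType R) (iota : X -> Xh)
    (f : X -> X)
    (hX : totally_bounded (@mdist R X))
    (hXh : is_completion iota)
    (hf : continuous f) :
  friedland_entropy iota f R = bd_entropy f [set: X] (@mdist R X) /\
  bowen_compacta_entropy f <= bd_entropy f [set: X] (@mdist R X).
Proof.
split.
  have [iso _ _] := hXh; apply: friedland_entropyE => //.
  apply: (subclosed_compact _ (compact_ptws (completion_compact hX hXh))) => //.
  exact: closed_closure.
by apply: ge_ereal_sup => _ [K _ <-]; exact: sub_bd_entropy.
Qed.
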